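(* Let $q$ be an odd prime power and let $P,Q,P'\in S$ be three distinct collinear points on a line $L\subset\mathbb A^2(\mathbb F_q)$ that is not tangent to $\Pi$, so that the corresponding triple of monic quadratics lies in $\mathcal D$. (i) If $L$ is the vertical line $a=c$, then $\operatorname{Res}(P,Q)$ is a nonzero square in $\mathbb F_q$, so the splitting class of the triple is a square. (ii) If $L$ is the non-vertical line $b=ma+c$, and $P=(a,b)$, $Q=(a',b')$, then $$\operatorname{Res}(P,Q)=(a'-a)^2(m^2+c).$$ Hence the splitting class is the square class of $m^2+c$: it is a square when $L$ is secant to $\Pi$ and a nonsquare when $L$ is external.
   Context: The monic quadratic $x^2+ax+b\in\mathbb F_q[x]$ is identified with the point $(a,b)\in\mathbb A^2(\mathbb F_q)$. $\Pi$ is the parabola $b=a^2/4$ and $S=\mathbb A^2(\mathbb F_q)\setminus\Pi$ is the set of separable monic quadratics. A non-vertical line is tangent, secant or external to $\Pi$ according as it meets $\Pi$ in exactly $1$, $2$ or $0$ points of $\mathbb A^2(\mathbb F_q)$; vertical lines ($a=\text{const}$) form a separate type and are not called tangent. $\mathcal D$ is the set of ordered triples $(u,v,w)$ of separable, pairwise coprime monic quadratics with $\mathfrak d(u,v,w)=0$, where $\mathfrak d(u,v,w)$ is the determinant of the matrix with rows $(u_0,u_1,1),(v_0,v_1,1),(w_0,w_1,1)$ (for $s=x^2+s_1x+s_0$). For a triple in $\mathcal D$ the splitting class is the class in $\mathbb F_q^\times/(\mathbb F_q^\times)^2$ of $\operatorname{Res}(u,v)$; it is the same for all three pairs. *)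

(* Defs.v *)
From HB Require Import structures.
From mathcomp Require Import all_boot all_order all_algebra all_fingroup all_solvable all_field.
From mathcomp Require Import ring.

Set Implicit Arguments.
Unset Strict Implicit.
Unset Printing Implicit Defensive.

Import GRing.Theory.
Local Open Scope ring_scope.

Section Plane.

Variable F : finFieldType.

Implicit Types (P : F * F) (L : {set F * F}).

Definition quad P : {poly F} := 'X^2 + P.1 *: 'X + P.2%:P.

Definition parabola : {set F * F} := [set P | P.2 == P.1 ^+ 2 / 4].

Definition sep_points : {set F * F} := ~: parabola.

Definition vertical_line (c : F) : {set F * F} := [set P | P.1 == c].

Definition slope_line (m c : F) : {set F * F} := [set P | P.2 == m * P.1 + c].

Definition is_line L : Prop :=
  exists2 k : F * F * F, (k.1.1, k.1.2) != (0, 0) &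
    L = [set P | k.1.1 * P.1 + k.1.2 * P.2 + k.2 == 0].

Definition non_vertical L : Prop := exists m c : F, L = slope_line m c.

Definition tangent L : Prop := non_vertical L /\ #|L :&: parabola| = 1%N.

Definition secant L : Prop := non_vertical L /\ #|L :&: parabola| = 2%N.

Definition external L : Prop := non_vertical L /\ #|L :&: parabola| = 0%N.

End Plane.

Section Triples.

Variable F : finFieldType.

Implicit Types (s u v w : {poly F}).

Definition monic_quadratic s : bool := (s \is monic) && (size s == 3%N).

Definition collinear_mx u v w : 'M[F]_3 :=
  \matrix_(i < 3, j < 3)
    (let s := [:: u; v; w]`_i in [:: s`_0; s`_1; 1]`_j).

Definition collinear_det u v w : F := \det (collinear_mx u v w).

Definition inD u v w : Prop :=
  [/\ [/\ monic_quadratic u, monic_quadratic v & monic_quadratic w],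
      [/\ separable_poly u, separable_poly v & separable_poly w],
      [/\ coprimep u v, coprimep u w & coprimep v w]
    & collinear_det u v w = 0].

Lemma coprime_res_unit u v : coprimep u v -> resultant u v \is a GRing.unit.
Proof. by move=> /eqP uv1; rewrite unitfE resultant_eq0 uv1. Qed.

Lemma inD_res_unit u v w : inD u v w -> resultant u v \is a GRing.unit.
Proof. by case=> _ _ [/coprime_res_unit]. Qed.

Definition unit_squares : {set {unit F}} := [set (t ^+ 2)%g | t : {unit F}].

Fact unit_squares_group_set : group_set unit_squares.
Proof.
apply/group_setP; split=> [|_ _ /imsetP[x _ ->] /imsetP[y _ ->]].
  by apply/imsetP; exists 1%g; rewrite ?inE ?expg1n.
apply/imsetP; exists (x * y)%g => //; rewrite expgMn //.
by apply: val_inj; rewrite /= mulrC.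
Qed.
Canonical unit_squares_group := Group unit_squares_group_set.

(* {unit F} is abelian, so unit_squares is normal and coset never takes its   *)
(* default value: coset_of unit_squares is F^* / (F^* )^2.                    *)
Definition square_class (t : {unit F}) : coset_of unit_squares :=
  coset unit_squares t.

Definition splitting_class u v w (uvwD : inD u v w) : coset_of unit_squares :=
  square_class (FinRing.unit F (inD_res_unit uvwD)).

Definition is_square (x : F) : Prop := exists z : F, x = z ^+ 2.

Definition class_of_squares (K : coset_of unit_squares) : Prop :=
  forall t : {unit F}, t \in (K : {set {unit F}}) -> is_square (val t).

Definition class_of_nonsquares (K : coset_of unit_squares) : Prop :=
  forall t : {unit F}, t \in (K : {set {unit F}}) -> ~ is_square (val t).

Lemma resultant_quadratic (u v : {poly F}) :
  monic_quadratic u -> monic_quadratic v ->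
  resultant u v
    = (v`_0 - u`_0) ^+ 2 - (v`_1 - u`_1) * (u`_1 * v`_0 - v`_1 * u`_0).
Proof.
case/andP=> /monicP + /eqP us /andP[/monicP + /eqP vs].
rewrite !lead_coefE us vs /= => u2 v2; rewrite /resultant.
pose f := [:: [:: u`_0; u`_1; 1; 0]; [:: 0; u`_0; u`_1; 1];
              [:: v`_0; v`_1; 1; 0]; [:: 0; v`_0; v`_1; 1]].
have {u2 v2}: forall i j, Sylvester_mx u v i j = (nth [::] f i)`_j.
  have [u3 v3]: u`_3 = 0 /\ v`_3 = 0 by rewrite !nth_default ?us ?vs.
  move=> i j; rewrite Sylvester_mxE; have:= ltn_ord j.
  case: splitP => k ->; have:= ltn_ord k; move: (nat_of_ord k) (nat_of_ord j);
    rewrite us vs /= => {i j k} - [|[|k]] // [|[|[|[|j]]]] // _ _;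
    by rewrite /= ?mulr1n ?mulr0n ?u2 ?v2 ?u3 ?v3.
move: (Sylvester_mx u v); rewrite us vs /= => M fM.
rewrite (expand_det_row _ ord0) !big_ord_recl big_ord0 /cofactor.
rewrite !(expand_det_row _ ord0) !big_ord_recl !big_ord0 /cofactor.
rewrite !(expand_det_row _ ord0) !big_ord_recl !big_ord0 /cofactor.
rewrite !det_mx11 !mxE !fM /= /bump /=; ring.
Qed.

Lemma collinear_detE (u v w : {poly F}) :
  collinear_det u v w
    = (v`_0 - u`_0) * (w`_1 - u`_1) - (w`_0 - u`_0) * (v`_1 - u`_1).
Proof.
rewrite /collinear_det (expand_det_row _ ord0) !big_ord_recl big_ord0 /cofactor.
rewrite !(expand_det_row _ ord0) !big_ord_recl !big_ord0 /cofactor !det_mx11 !mxE /=.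
rewrite /bump /=; ring.
Qed.

Lemma square_class_eq (s t : {unit F}) (z : F) :
  val t = z ^+ 2 * val s -> square_class s = square_class t.
Proof.
move=> ts; have z0: z != 0.
  by apply: contraTneq (valP t) => z0; rewrite ts z0 expr0n mul0r unitr0.
have zU: z \is a GRing.unit by rewrite unitfE.
rewrite /square_class.
have -> : t = ((FinRing.unit F zU ^+ 2) * s)%g by apply: val_inj; rewrite /= ts.
have nU (x : {unit F}) : x \in 'N(unit_squares)%g.
  apply: (subsetP (cent_sub _)); apply/centP => y _.
  by apply: val_inj; rewrite /= mulrC.
rewrite morphM //= [X in (X * _)%g]coset_id ?mul1g //.
by apply/imsetP; exists (FinRing.unit F zU).
Qed.

(* The class does not depend on the pair used: iterating gives all three.     *)
Lemma splitting_class_rot (u v w : {poly F})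
    (h : inD u v w) (h' : inD v w u) : splitting_class h = splitting_class h'.
Proof.
have [[uQ vQ wQ] _ [uv uw vw] d0] := h.
have e1 := resultant_quadratic uQ vQ; have e2 := resultant_quadratic vQ wQ.
have:= coprime_res_unit uv; rewrite unitfE => r0.
move: d0; rewrite collinear_detE => /eqP; rewrite subr_eq0 => /eqP d0.
have [p0|p0] := eqVneq (v`_1 - u`_1) 0.
- have q0 : v`_0 - u`_0 != 0 by apply: contra r0 => /eqP q0; rewrite e1 p0 q0 expr0n mul0r subr0.
  have w1 : w`_1 = u`_1.
    by apply/eqP; rewrite -subr_eq0; move/eqP: d0; rewrite p0 mulr0 mulf_eq0 (negPf q0).
  apply: (@square_class_eq _ _ ((w`_0 - v`_0) / (v`_0 - u`_0))).
  rewrite /= e1 e2 w1; have <- : v`_1 = u`_1 by apply/eqP; rewrite -subr_eq0 p0.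
  by field.
- apply: (@square_class_eq _ _ ((w`_1 - v`_1) / (v`_1 - u`_1))).
  rewrite /= e1 e2.
  have -> : w`_0 = u`_0 + (v`_0 - u`_0) * (w`_1 - u`_1) / (v`_1 - u`_1).
    by rewrite d0 mulfK // addrC subrK.
  by field.
Qed.

End Triples.

(* Main.v *)
Require Import Defs.
From HB Require Import structures.
From mathcomp Require Import all_boot all_order all_algebra all_fingroup all_solvable all_field.
From mathcomp Require Import ring.

Set Implicit Arguments.
Unset Strict Implicit.
Unset Printing Implicit Defensive.

Import GRing.Theory.
Local Open Scope ring_scope.

(** Put [R = Res(P, Q)] for the quadratics attached to two points.  As a
    polynomial in the coordinates,
      [R = (b' - b)^2 - (a' - a) (a b' - a' b)].
    On a vertical line [a' = a] and [R = (b' - b)^2] is visibly a square.  On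
    [b = m a + c] the term [a b' - a' b] collapses to [c (a - a')], and
    [R = (a' - a)^2 (m^2 + c)] (lemma [resultant_slope]).

    The number [m^2 + c] is the discriminant of the equation [a^2/4 = m a + c]
    that locates the meeting points of the line and the parabola: completing
    the square turns this equation into
    [((a - 2 m) / 2)^2 = m^2 + c] (lemma [mem_slope_parabola]).  Three facts
    follow.  If [m^2 + c = 0] there is exactly one meeting point and the line
    is tangent; hence on a line that is not tangent [R != 0], and distinct
    points give coprime quadratics (lemma [nontangent_coprime]).  A meeting
    point exhibits a square root of [m^2 + c], which settles the secant case.
    Conversely a square root of [m^2 + c] yields a meeting point, which settles
    the external case.

    The classes themselves are handled through the fact that the elements of
    the class of [t] are the products of [t] by nonzero squares (lemma
    [square_class_mem]). *)

Section QuadraticsAndLines.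

Variable F : finFieldType.

Implicit Types (P Q R : F * F) (L : {set F * F}) (m c : F).

(** In characteristic two the equation [#|F| * 1 = 0] (Lagrange in the additive
    group) would read [1 = 0] for odd [#|F|]. *)
Lemma odd_card_two_neq0 : odd #|F| -> (2 : F) != 0.
Proof.
move=> oddF; apply/eqP=> two0.
have /eqP: (1 : F) *+ #|F| = 0.
  by have:= expg_cardG (in_setT (1 : F)); rewrite cardsT FinRing.zmodXgE.
rewrite -[#|F|]odd_double_half oddF mulrnDr -mul2n mulrnA two0 mul0rn addr0.
by rewrite oner_eq0.
Qed.

Lemma four_neq0 : (2 : F) != 0 -> (4 : F) != 0.
Proof. by move=> two0; rewrite (natrM _ 2 2) mulf_neq0. Qed.

(** * Monic quadratics *)

Lemma quad_coef P : ((quad P)`_0 = P.2) * ((quad P)`_1 = P.1).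
Proof.
split; rewrite /quad !coefD coefXn coefZ coefX coefC /=.
  by rewrite mulr0 !add0r.
by rewrite mulr1 add0r addr0.
Qed.

Lemma quad_monic P : monic_quadratic (quad P).
Proof.
have sz : (size (P.1 *: 'X + P.2%:P)%R < 3)%N.
  rewrite (leq_ltn_trans (size_polyD _ _)) // gtn_max.
  rewrite (leq_ltn_trans (size_scale_leq _ _)) ?size_polyX //.
  by rewrite (leq_ltn_trans (size_polyC_leq1 _)).
rewrite /monic_quadratic /quad -addrA monicE lead_coefDl ?size_polyXn //.
by rewrite lead_coefXn size_polyDl ?size_polyXn ?eqxx.
Qed.

Lemma resultant_quad P Q :
  resultant (quad P) (quad Q)
    = (Q.2 - P.2) ^+ 2 - (Q.1 - P.1) * (P.1 * Q.2 - Q.1 * P.2).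
Proof. by rewrite resultant_quadratic ?quad_monic // !quad_coef. Qed.

Lemma coprimep_quad P Q :
  resultant (quad P) (quad Q) != 0 -> coprimep (quad P) (quad Q).
Proof.
rewrite resultant_eq0 -leqNgt leq_eqVlt ltnS leqn0 => /orP[//|].
rewrite size_poly_eq0 gcdp_eq0 => /andP[/eqP P0 _].
by have:= quad_monic P; rewrite /monic_quadratic P0 size_poly0 andbF.
Qed.

(** The identity [4 s - s'^2 = 4 b - a^2] for [s = x^2 + a x + b] is a Bezout
    relation between [s] and its derivative off the parabola. *)
Lemma separable_quad P :
  (2 : F) != 0 -> P \in sep_points F -> separable_poly (quad P).
Proof.
move=> two0; rewrite !inE => Poff; have four0 := four_neq0 two0.
rewrite unlock; apply/Bezout_coprimepP.
exists (4%:P, - (quad P)^`()) => /=.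
have -> : 4%:P * quad P + - (quad P)^`() * (quad P)^`()
          = (4 * P.2 - P.1 ^+ 2)%:P.
  rewrite /quad !derivE -!mul_polyC polyCB polyC_exp !polyCM.
  by ring.
rewrite polyC_eqp1 subr_eq0; apply: contra Poff => /eqP <-.
by rewrite mulrC mulKf.
Qed.

(** * Lines and the parabola *)

Lemma line_cases L : is_line L ->
  (exists c, L = vertical_line c) \/ (exists m c, L = slope_line m c).
Proof.
case=> [[[k l] r]] /=; have [-> k0 ->|l0 _ ->] := eqVneq l 0; [left | right].
  have {}k0 : k != 0 by apply: contra k0 => /eqP->.
  exists (- r / k); apply/setP=> P; rewrite !inE mul0r addr0 addr_eq0.
  by rewrite -[RHS](inj_eq (mulfI k0)) mulrCA divff ?mulr1.
exists (- k / l), (- r / l); apply/setP=> P; rewrite !inE.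
rewrite -[RHS](inj_eq (mulfI l0)) -[RHS]subr_eq0; congr (_ == 0).
by field.
Qed.

Lemma resultant_slope m c P Q :
    P \in slope_line m c -> Q \in slope_line m c ->
  resultant (quad P) (quad Q) = (Q.1 - P.1) ^+ 2 * (m ^+ 2 + c).
Proof. by rewrite !inE resultant_quad => /eqP-> /eqP->; ring. Qed.

Lemma resultant_vertical c P Q :
    P \in vertical_line c -> Q \in vertical_line c ->
  resultant (quad P) (quad Q) = (Q.2 - P.2) ^+ 2.
Proof. by rewrite !inE resultant_quad => /eqP-> /eqP->; ring. Qed.

Lemma slope_line_inj m c P Q :
  P \in slope_line m c -> Q \in slope_line m c -> P.1 = Q.1 -> P = Q.
Proof.
by case: P Q => [a b] [a' b']; rewrite !inE /= => /eqP-> /eqP-> ->.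
Qed.

Lemma vertical_line_inj c P Q :
  P \in vertical_line c -> Q \in vertical_line c -> P.2 = Q.2 -> P = Q.
Proof.
by case: P Q => [a b] [a' b']; rewrite !inE /= => /eqP-> /eqP-> ->.
Qed.

Lemma mem_slope_parabola m c P : (2 : F) != 0 ->
  (P \in slope_line m c :&: parabola F)
    = (P.2 == m * P.1 + c) && (((P.1 - 2 * m) / 2) ^+ 2 == m ^+ 2 + c).
Proof.
move=> two0; have four0 := four_neq0 two0; rewrite !inE.
apply: andb_id2l => /eqP ->; rewrite -[LHS]subr_eq0 -[RHS]subr_eq0 -oppr_eq0.
by congr (_ == 0); field; rewrite ?two0 ?four0.
Qed.

(** The double root [a = 2 m] of the intersection equation is the abscissa of
    the point of contact. *)
Lemma tangent_slope m c :
  (2 : F) != 0 -> m ^+ 2 + c = 0 -> tangent (slope_line m c).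
Proof.
move=> two0 mc0; split; first by exists m, c.
apply/eqP/cards1P; exists (2 * m, m * (2 * m) + c); apply/setP=> -[a b].
rewrite mem_slope_parabola // mc0 inE xpair_eqE expf_eq0 /= mulf_eq0 invr_eq0.
rewrite (negPf two0) orbF subr_eq0 andbC.
by apply: andb_id2l => /eqP->.
Qed.

Lemma nontangent_slope_neq0 m c :
  (2 : F) != 0 -> ~ tangent (slope_line m c) -> m ^+ 2 + c != 0.
Proof. by move=> two0 nt; apply/eqP=> /(tangent_slope two0)/nt. Qed.

Lemma nontangent_coprime L P Q :
    (2 : F) != 0 -> is_line L -> ~ tangent L -> P \in L -> Q \in L -> P <> Q ->
  coprimep (quad P) (quad Q).
Proof.
move=> two0 /line_cases[[c ->]|[m [c ->]]] nt PL QL PQ; apply: coprimep_quad.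
  rewrite (resultant_vertical PL QL) expf_neq0 // subr_eq0.
  by apply/eqP=> /esym/(vertical_line_inj PL QL)/PQ.
rewrite (resultant_slope PL QL) mulf_neq0 ?nontangent_slope_neq0 //.
rewrite expf_neq0 // subr_eq0.
by apply/eqP=> /esym/(slope_line_inj PL QL)/PQ.
Qed.

Lemma collinear_det_line L P Q R :
    is_line L -> P \in L -> Q \in L -> R \in L ->
  collinear_det (quad P) (quad Q) (quad R) = 0.
Proof.
move=> /line_cases[[c ->]|[m [c ->]]]; rewrite !inE collinear_detE !quad_coef.
  by move=> /eqP-> /eqP-> /eqP->; ring.
by move=> /eqP-> /eqP-> /eqP->; ring.
Qed.

Lemma line_triple_inD L P Q R :
    (2 : F) != 0 -> is_line L -> ~ tangent L ->
    P \in sep_points F -> Q \in sep_points F -> R \in sep_points F ->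
    P \in L -> Q \in L -> R \in L -> P <> Q -> P <> R -> Q <> R ->
  inD (quad P) (quad Q) (quad R).
Proof.
move=> two0 lineL nt PS QS RS PL QL RL PQ PR QR.
split; first by split; apply: quad_monic.
- by split; apply: separable_quad.
- by split; apply: nontangent_coprime lineL nt _ _ _.
exact: collinear_det_line lineL PL QL RL.
Qed.

(** * Square classes *)

Lemma square_class_mem (s t : {unit F}) :
    s \in (square_class t : {set {unit F}}) ->
  exists2 z : F, z != 0 & val s = z ^+ 2 * val t.
Proof.
have tN : t \in 'N(unit_squares F)%g.
  apply: (subsetP (cent_sub _)); apply/centP => y _.
  by apply: val_inj; rewrite /= mulrC.
rewrite /square_class val_coset // => /rcosetP[_ /imsetP[z _ ->] ->].
by exists (val z) => //; rewrite -unitfE; apply: valP.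
Qed.

Lemma square_class_of_squares (t : {unit F}) :
  is_square (val t) -> class_of_squares (square_class t).
Proof.
move=> [w tw] s /square_class_mem[z _ ->].
by exists (z * w); rewrite tw exprMn.
Qed.

Lemma square_class_of_nonsquares (t : {unit F}) :
  ~ is_square (val t) -> class_of_nonsquares (square_class t).
Proof.
move=> tns s /square_class_mem[z z0 ->] [w zw]; apply: tns; exists (w / z).
by rewrite expr_div_n -zw mulrC mulKf // expf_neq0.
Qed.

Lemma secant_slope_square m c :
  (2 : F) != 0 -> secant (slope_line m c) -> is_square (m ^+ 2 + c).
Proof.
move=> two0 [_ two_pts].
have /card_gt0P[R] : (0 < #|slope_line m c :&: parabola F|)%N by rewrite two_pts.
rewrite mem_slope_parabola // => /andP[_ /eqP <-].
by exists ((R.1 - 2 * m) / 2).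
Qed.

Lemma external_slope_nonsquare m c :
  (2 : F) != 0 -> external (slope_line m c) -> ~ is_square (m ^+ 2 + c).
Proof.
move=> two0 [_ /cards0_eq no_pt] [z mcz].
(* a = 2 (m + z) solves ((a - 2 m) / 2)^2 = z^2. *)
pose a := 2 * (m + z).
have: (a, m * a + c) \in slope_line m c :&: parabola F.
  by rewrite mem_slope_parabola //= eqxx mcz; apply/eqP; rewrite /a; field.
by rewrite no_pt inE.
Qed.

End QuadraticsAndLines.

Theorem proposition8p2 (F : finFieldType) (hq : odd #|F|)
    (L : {set F * F}) (hL : is_line L) (hLt : ~ tangent L)
    (P Q P' : F * F)
    (hPS : P \in sep_points F) (hQS : Q \in sep_points F)
    (hPS' : P' \in sep_points F)
    (hPL : P \in L) (hQL : Q \in L) (hPL' : P' \in L)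
    (hPQ : P <> Q) (hPP' : P <> P') (hQP' : Q <> P') :
  exists hD : inD (quad P) (quad Q) (quad P'),
    (forall c : F, L = vertical_line c ->
       [/\ resultant (quad P) (quad Q) != 0,
           is_square (resultant (quad P) (quad Q))
         & class_of_squares (splitting_class hD)])
    /\
    (forall m c : F, L = slope_line m c ->
       [/\ resultant (quad P) (quad Q) = (Q.1 - P.1) ^+ 2 * (m ^+ 2 + c),
           exists2 t : {unit F}, val t = m ^+ 2 + c
             & splitting_class hD = square_class t,
           secant L -> class_of_squares (splitting_class hD)
         & external L -> class_of_nonsquares (splitting_class hD)]).
Proof.
have two0 := odd_card_two_neq0 hq.
have hD := line_triple_inD two0 hL hLt hPS hQS hPS' hPL hQL hPL' hPQ hPP' hQP'.
exists hD; split=> [c Lc | m c Lmc].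
  have PQsq : is_square (resultant (quad P) (quad Q)).
    by exists (Q.2 - P.2); apply: (@resultant_vertical _ c); rewrite -Lc.
  split=> //; first by rewrite -unitfE; apply: inD_res_unit hD.
  exact: square_class_of_squares.
have PQres : resultant (quad P) (quad Q) = (Q.1 - P.1) ^+ 2 * (m ^+ 2 + c).
  by apply: resultant_slope; rewrite -Lmc.
have mcU : m ^+ 2 + c \is a GRing.unit.
  by rewrite unitfE nontangent_slope_neq0 // -Lmc.
have classE : splitting_class hD = square_class (FinRing.unit F mcU).
  by apply/esym/(@square_class_eq _ _ _ (Q.1 - P.1)).
rewrite classE Lmc; split=> //; first by exists (FinRing.unit F mcU).
  by move=> /(secant_slope_square two0) ?; apply: square_class_of_squares.
by move=> /(external_slope_nonsquare two0) ?; apply: square_class_of_nonsquares.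
Qed.
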